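(* Consider the optimization problem (NLP): maximize $f(\vec x)$ subject to $g_i(\vec x)\le 0$ for $i=1,\dots,m$, $\vec x\in\mathbb{R}^n$, where $f,g_1,\dots,g_m:\mathbb{R}^n\to\mathbb{R}$ are twice continuously differentiable and $f$ is concave. If (NLP) is KT-invex, then it is weakly boundary-invex.
   Context: Let $F=\{\vec x\in\mathbb{R}^n: g_i(\vec x)\le 0,\ i=1,\dots,m\}$ be the feasible set; a point is infeasible for (NLP) if it is not in $F$. A point $\vec x^*\in F$ is a KKT point of (NLP) if there are $\mu_1,\dots,\mu_m\ge 0$ with $\nabla f(\vec x^* )=\sum_{i=1}^m\mu_i\nabla g_i(\vec x^* )$ and $\mu_i g_i(\vec x^* )=0$ for all $i$. (NLP) is KT-invex if every KKT point is a global optimizer (global maximizer of $f$ on $F$). For each $i$ such that the constraint $g_i(\vec x)\le 0$ is non-convex (i.e. $g_i$ is not a convex function), let (NLP$_i$) be the problem: minimize $f(\vec x)$ subject to $g_i(\vec x)=0$. The KKT multiplier of a point $\vec x^*$ in (NLP$_i$) is the real number $\lambda$ with $\nabla f(\vec x^* )=-\lambda\nabla g_i(\vec x^* )$. (NLP) is weakly boundary-invex if, for each non-convex constraint $g_i\le 0$, either (NLP$_i$) is unbounded or at least one of the following holds for its global minimum $\vec x^*$: (1) $\vec x^*$ is infeasible for (NLP); (2) $\vec x^*$ is not a strict minimizer of (NLP$_i$); (3) the KKT multiplier for $\vec x^*$ in (NLP$_i$) is non-negative; (4) there exist constraints $g_j(\vec x)\le 0$, $j\neq i$, of (NLP) that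 are active at $\vec x^*$ (i.e. $g_j(\vec x^* )=0$).
   Formalization: The case n = 1 is excluded, since the claim fails there (f = x, g = x + x³); and condition (3) counts as satisfied when no unique KKT multiplier exists at the minimum (gradient of g_i zero), where the claim would be undefined or false (f = x, g = y² − x³). *)

(* Defs.v *)
(* MathComp-Analysis *)
From mathcomp Require Import all_boot all_order all_algebra.
From mathcomp Require Import boolp classical_sets reals topology normedtype.
From mathcomp Require Import derive convex.
Set Implicit Arguments.
Unset Strict Implicit.
Unset Printing Implicit Defensive.

Import Order.TTheory GRing.Theory Num.Theory.
Import numFieldNormedType.Exports.

Local Open Scope classical_set_scope.
Local Open Scope ring_scope.

Definition partial (R : realType) (n : nat) (j : 'I_n) (f : 'rV[R]_n -> R)
    (x : 'rV[R]_n) : R :=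
  'D_(delta_mx 0 j) f x.

Definition grad (R : realType) (n : nat) (f : 'rV[R]_n -> R)
    (x : 'rV[R]_n) : 'rV[R]_n :=
  \row_(j < n) partial j f x.

(* [class_C k f]: f is k times continuously differentiable on R^n. *)
Fixpoint class_C (R : realType) (n k : nat) (f : 'rV[R]_n -> R) : Prop :=
  if k is k'.+1 then
    (forall x, differentiable f x) /\ forall j, class_C k' (partial j f)
  else continuous f.

Definition convex_fun (R : realType) (n : nat) (f : 'rV[R]_n -> R) : Prop :=
  convex_function [set: convex_lmodType 'rV[R]_n] f.

Definition concave_fun (R : realType) (n : nat) (f : 'rV[R]_n -> R) : Prop :=
  convex_fun (fun x => - f x).

(* (NLP): maximize f subject to g i x <= 0 for all i : 'I_m. *)

Definition feasible (R : realType) (n m : nat) (g : 'I_m -> 'rV[R]_n -> R) :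
    set 'rV[R]_n :=
  [set x | forall i, g i x <= 0].

Definition kkt_point (R : realType) (n m : nat) (f : 'rV[R]_n -> R)
    (g : 'I_m -> 'rV[R]_n -> R) (x : 'rV[R]_n) : Prop :=
  feasible g x /\
  exists mu : 'I_m -> R,
    [/\ forall i, 0 <= mu i,
        grad f x = \sum_(i < m) mu i *: grad (g i) x
      & forall i, mu i * g i x = 0].

Definition kt_invex (R : realType) (n m : nat) (f : 'rV[R]_n -> R)
    (g : 'I_m -> 'rV[R]_n -> R) : Prop :=
  forall x, kkt_point f g x -> forall y, feasible g y -> f y <= f x.

(* (NLP_i): minimize f subject to h x = 0, where h := g i. *)

Definition unbounded_eq (R : realType) (n : nat) (f h : 'rV[R]_n -> R) : Prop :=
  ~ has_lbound (f @` [set x | h x = 0]).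

Definition global_min_eq (R : realType) (n : nat) (f h : 'rV[R]_n -> R)
    (x : 'rV[R]_n) : Prop :=
  h x = 0 /\ forall y, h y = 0 -> f x <= f y.

Definition strict_min_eq (R : realType) (n : nat) (f h : 'rV[R]_n -> R)
    (x : 'rV[R]_n) : Prop :=
  h x = 0 /\ forall y, h y = 0 -> y <> x -> f x < f y.

(* "The" multiplier of x is a definite description: lam is the only real
   satisfying the stationarity equation.  None exists when grad h x = 0. *)
Definition kkt_multiplier_eq (R : realType) (n : nat) (f h : 'rV[R]_n -> R)
    (x : 'rV[R]_n) (lam : R) : Prop :=
  unique (fun l : R => grad f x = - l *: grad h x) lam.

(* The four alternatives are required of every global minimum of (NLP_i), hence
   of none if the infimum is not attained.  The third one says that the
   multiplier, when it is defined, is non-negative. *)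
Definition weakly_boundary_invex (R : realType) (n m : nat)
    (f : 'rV[R]_n -> R) (g : 'I_m -> 'rV[R]_n -> R) : Prop :=
  forall i, ~ convex_fun (g i) ->
    unbounded_eq f (g i) \/
    forall x, global_min_eq f (g i) x ->
      [\/ ~ feasible g x,
          ~ strict_min_eq f (g i) x,
          forall lam, kkt_multiplier_eq f (g i) x lam -> 0 <= lam
        | exists2 j, j <> i & g j x = 0].

(* In dimension 1 KT-invexity does not imply weak boundary-invexity: take m = 1,
   f x = x and g x = x + x ^+ 3.  The only KKT point is 0, and it maximizes f on
   {g <= 0} = ]-oo, 0].  But {g = 0} = {0}, so 0 is a strict (the only) minimizer
   of f on {g = 0}; it is feasible and its multiplier is -1. *)

(* Main.v *)
(* If all alternatives failed at a global minimum [x] of (NLP_i), then [x] would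
   be feasible with a negative multiplier, hence a KKT point of (NLP), hence a
   maximizer of [f] on the feasible set.  The multiplier being unique,
   [grad (g i) x] is nonzero, so in dimension at least 2 the point [x] is not
   isolated in the zero set of [g i].  The other constraints being inactive at
   [x], a nearby zero [y] of [g i] is feasible, so [f y <= f x], whereas
   strictness of the minimum gives [f x < f y]. *)
Require Import Defs.
From mathcomp Require Import all_boot all_order all_algebra.
From mathcomp Require Import boolp classical_sets reals topology normedtype.
From mathcomp Require Import derive convex.
From mathcomp Require Import lra.
Import Order.TTheory GRing.Theory Num.Theory.
Import numFieldNormedType.Exports.
Local Open Scope classical_set_scope.
Local Open Scope ring_scope.

(** With [d := 'D_v h x], the difference quotient [s^-1 * h (s *: v + x)] tends to [d], so [d] times
    it tends to [d * d > 0] and is positive for all small nonzero [s] of either sign. Multiplying by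
    [s = t] and by [s = - t] gives the two signs. *)
Lemma derive_neq0_sign_change (R : realType) (V : normedModType R)
    (h : V -> R) (x v : V) :
  h x = 0 -> derivable h x v -> 'D_v h x != 0 ->
  \forall t \near 0^'+,
    0 < 'D_v h x * h (t *: v + x) /\ 'D_v h x * h (- t *: v + x) < 0.
Proof.
move=> hx0 dh; set d := 'D_v h x => d0.
have qpos : \forall s \near 0^', 0 < d * (s^-1 * h (s *: v + x)).
  have /cvgr_gt : d * (s^-1 *: ((h \o shift x) (s *: v) - h x))
      @[s --> 0^'] --> d * d by apply: cvgMl_tmp; exact: dh.
  move=> /(_ 0); rewrite -expr2 exprn_even_gt0 // => /(_ d0).
  by apply: filterS => s /=; rewrite hx0 subr0.
move: qpos => /nbhs_ballP[e /= e0 eq].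
near=> t.
have t0 : 0 < t by [].
have te : t < e by near: t; exact: nbhs_right_lt.
have qp s : `|s| = t -> 0 < d * (s^-1 * h (s *: v + x)).
  move=> st; apply: eq; last by rewrite -normr_gt0 st.
  by rewrite /ball /= sub0r normrN st.
split.
  by have := qp t (gtr0_norm t0); rewrite mulrCA pmulr_rgt0 ?invr_gt0.
have := qp (- t); rewrite normrN gtr0_norm // => /(_ erefl).
by rewrite mulrCA invrN mulNr oppr_gt0 pmulr_rlt0 ?invr_gt0.
Unshelve. all: by end_near. Qed.

(* A zero is found by the intermediate value theorem on a small parabolic arc
   joining [x - t e_j] to [x + t e_j] without meeting [x]; it bulges in a second
   coordinate direction. *)
Lemma zero_set_not_isolated (R : realType) (n : nat) (hn : n <> 1%N)
    (h : 'rV[R]_n -> R) (x : 'rV[R]_n) :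
  continuous h -> differentiable h x -> h x = 0 -> grad h x != 0 ->
  forall U, nbhs x U -> exists y, [/\ U y, y <> x & h y = 0].
Proof.
move=> hc hd hx0 /eqP gh0 U /nbhs_ballP[e /= e0 eU].
have [j dj0] : exists j, partial j h x != 0.
  apply: contrapT => /forallNP P0; apply: gh0; apply/rowP => j.
  by rewrite !mxE; apply/eqP/negPn/negP/P0.
(* The index [j] excludes [n = 0], and [hn] excludes [n = 1]. *)
have [k kj] : exists k : 'I_n, k != j.
  case: n hn j {h x hc hd hx0 gh0 U eU dj0} => [|[|n]] // hn j; first by case: j.
  by exists (lift j ord0); rewrite eq_sym neq_lift.
set v : 'rV[R]_n := delta_mx 0 j; set w : 'rV[R]_n := delta_mx 0 k.
set d := partial j h x in dj0.
have vw0 : 0 < `|v| + `|w|.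
  rewrite ltr_wpDr // normr_gt0; apply/eqP => /rowP/(_ j)/eqP.
  by rewrite !mxE !eqxx oner_eq0.
have sgn := @derive_neq0_sign_change _ _ h x v hx0 (diff_derivable hd) dj0.
have : \forall t \near 0^'+, [/\ 0 < d * h (t *: v + x),
    d * h (- t *: v + x) < 0, 0 < t & t * (`|v| + `|w|) < e].
  near=> t.
  have [p1 p2] : 0 < d * h (t *: v + x) /\ d * h (- t *: v + x) < 0.
    by near: t.
  split=> //; rewrite -ltr_pdivlMr //.
  by near: t; apply: nbhs_right_lt; rewrite divr_gt0.
move=> /filter_ex[t [pp pn t0 te]].
(* The [w] term vanishes at [s = 1] and [s = - 1], so the arc ends at [t *: v + x] and
   [- t *: v + x], where [d * h] has opposite signs. *)
pose c (s : R) := (t * s) *: v + (t * (1 - s * s)) *: w + x.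
have cc : continuous c.
  move=> s; apply: cvgD; last exact: cvg_cst.
  apply: cvgD; apply: cvgZr_tmp; apply: cvgMl_tmp; first exact: cvg_id.
  by apply: cvgB; [exact: cvg_cst | exact: (cvgM cvg_id cvg_id)].
have := @IVT R (fun s => d * h (c s)) (- 1) 1 0.
have c1 : c 1 = t *: v + x by rewrite /c !mulr1 subrr mulr0 scale0r addr0.
have cN1 : c (- 1) = - t *: v + x.
  by rewrite /c mulrNN !mulrN1 mulr1 subrr mulr0 scale0r addr0.
rewrite c1 cN1 => /(_ _)[| | |s].
- by lra.
- apply: continuous_subspaceT => s; apply: cvgMl_tmp.
  exact: (@continuous_comp _ _ _ c h s (cc s) (hc _)).
- by rewrite ge_min le_max (ltW pn) (ltW pp) orbT.
rewrite in_itv /= => /andP[s1 s2] /eqP.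
rewrite mulf_eq0 (negbTE dj0) /= => /eqP hs.
exists (c s); split => //.
  (* Since [s] lies in [[-1, 1]], both coefficients of the arc are at most [t] in absolute value. *)
  apply: eU; rewrite -ball_normE /= distrC /c addrK; apply: le_lt_trans te.
  apply: (le_trans (ler_normD _ _)); rewrite !normrZ [leRHS]mulrDr.
  apply: lerD; apply: ler_wpM2r => //.
    by rewrite gtr0_norm // ger_pMr // ler_norml s1.
  by rewrite gtr0_norm // ger_pMr // ler_norml; nra.
(* If the arc met [x], coordinate [j] would force [s = 0], but there coordinate [k] is off by
   [t > 0]. *)
move=> /eqP; rewrite /c -subr_eq0 addrK => /eqP/rowP cs.
have := cs j; rewrite !mxE !eqxx /= eq_sym (negbTE kj) mulr0 addr0 mulr1.
move=> /eqP; rewrite mulf_eq0 (gt_eqF t0) /= => /eqP s0.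
have := cs k; rewrite !mxE !eqxx /= (negbTE kj) s0 mulr0 mul0r add0r subr0 !mulr1.
by move=> /eqP; rewrite (gt_eqF t0).
Unshelve. all: by end_near. Qed.

Theorem theorem3 (R : realType) (n m : nat) (hn : n <> 1%N)
    (f : 'rV[R]_n -> R) (g : 'I_m -> 'rV[R]_n -> R)
    (f_C2 : class_C 2 f) (g_C2 : forall i, class_C 2 (g i))
    (f_concave : concave_fun f) :
  kt_invex f g -> weakly_boundary_invex f g.
Proof.
move=> inv i _; right => x [gx0 _].
apply: contrapT => nalt.
have fx : feasible g x by apply: contrapT => ?; apply: nalt; apply: Or41.
have [_ smin] : strict_min_eq f (g i) x.
  by apply: contrapT => ?; apply: nalt; apply: Or42.
have nlam : ~ forall lam, kkt_multiplier_eq f (g i) x lam -> 0 <= lam.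
  by move=> ?; apply: nalt; apply: Or43.
have nact : ~ exists2 j, j <> i & g j x = 0.
  by move=> ?; apply: nalt; apply: Or44.
have [lam [[lamE lamU] lam0]] : exists lam,
    kkt_multiplier_eq f (g i) x lam /\ lam < 0.
  move/existsNP: nlam => [lam /not_implyP[lamP /negP]].
  by rewrite -ltNge => lam0; exists lam.
have gdiff j y : differentiable (g j) y by case: (g_C2 j).
have gcont j : continuous (g j) by move=> y; exact: differentiable_continuous.
have fmax : forall y, feasible g y -> f y <= f x.
  (* The minus sign matches the convention of (NLP_i); [lam < 0] makes this multiplier
     admissible. *)
  apply: inv; split=> //; exists (fun j => if j == i then - lam else 0); split.
  - by move=> j; case: ifP => // _; rewrite oppr_ge0 ltW.
  - rewrite (bigD1 i) //= eqxx lamE big1 ?addr0 // => j /negbTE ->.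
    by rewrite scale0r.
  - by move=> j; case: eqP => [->|_]; rewrite ?gx0 ?mulr0 ?mul0r.
(* With a zero gradient [lam + 1] would be a multiplier as well. *)
have ggrad : grad (g i) x != 0.
  apply/eqP => g0; have /eqP : lam = lam + 1.
    by apply: lamU; rewrite lamE g0 !scaler0.
  by rewrite -subr_eq0 opprD addNKr oppr_eq0 oner_eq0.
(* Each strict inequality persists near [x] by continuity, and there are finitely many of them. *)
have inactive : \forall y \near x, forall j, j != i -> g j y < 0.
  apply: (@filter_forall _ _ _ (nbhs x) (nbhs_filter x)) => j.
  have [->|ji] := eqVneq j i; first exact: nearW.
  have gj : g j x < 0.
    rewrite lt_neqAle fx andbT; apply/eqP => gj; apply: nact.
    by exists j => //; exact/eqP.
  by apply: filterS (cvgr_lt _ (gcont j x) _ gj) => y gy _.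
have [y [yn yx gy0]] :=
  zero_set_not_isolated _ _ hn _ _ (gcont i) (gdiff i x) gx0 ggrad _ inactive.
have := smin y gy0 yx; rewrite ltNge fmax // => j.
by have [->|/yn/ltW//] := eqVneq j i; rewrite gy0.
Qed.
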